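(* Let $D=(E,\mathcal{F})$ be a delta-matroid. Then $D$ has a twist of width one (that is, $w(D*B)=1$ for some $B\subseteq E$) if and only if there is some $A\subseteq E$ such that (1) $A$ is a separator of the matroid $D_{\min}$, (2) $D|A$ is a matroid, and (3) $D|\overline{A}$ is of width one, where $\overline{A}=E-A$.
   Context: A delta-matroid $D=(E,\mathcal{F})$ consists of a finite set $E$ (the ground set) and a non-empty set $\mathcal{F}$ of subsets of $E$ (the feasible sets) satisfying the Symmetric Exchange Axiom: for all $X,Y\in\mathcal{F}$ and every $u\in X\triangle Y$ there is $v\in X\triangle Y$ (possibly $v=u$) with $X\triangle\{u,v\}\in\mathcal{F}$. Here $\triangle$ denotes symmetric difference. A matroid is a delta-matroid whose feasible sets all have the same size; its feasible sets are then its bases. The width of $D$ is $w(D)=\max_{F\in\mathcal{F}}|F|-\min_{F\in\mathcal{F}}|F|$. For $A\subseteq E$, the twist of $D$ with respect to $A$ is the delta-matroid $D*A=(E,\{A\triangle F: F\in\mathcal{F}\})$. A twist of $D$ is any $D*A$ with $A\subseteq E$ (including $A=\emptyset$). $D_{\min}=(E,\mathcal{F}_{\min})$, where $\mathcal{F}_{\min}$ is the set of feasible sets of $D$ of minimum size; it is a matroid. For a matroid $M$ on $E$ with rank function $r$ ($r(X)$ is the size of the largest intersection of $X$ with a basis of $M$), a set $A\subseteq E$ is a separator of $M$ if $A$ is a union of components of $M$; equivalently $r(A)+r(E-A)=r(E)$. Both $\emptyset$ and $E$ are separators. Deletion and contraction: an element $e$ is a coloop of $D$ if it is in every feasible set and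 a loop if it is in no feasible set. If $e$ is not a coloop, $D\setminus e=(E-e,\{F: F\in\mathcal{F}, F\subseteq E-e\})$. If $e$ is not a loop, $D/e=(E-e,\{F-e: F\in\mathcal{F}, e\in F\})$. If $e$ is a loop or coloop, then $D/e=D\setminus e$. The result of a sequence of deletions and contractions does not depend on the order. The restriction $D|A$ is obtained from $D$ by deleting all elements of $E-A$. *)

(* Defs.v *)
From mathcomp Require Import all_boot.

Set Implicit Arguments.
Unset Strict Implicit.
Unset Printing Implicit Defensive.

Definition symdiff (T : finType) (A B : {set T}) : {set T} :=
  (A :\: B) :|: (B :\: A).

Notation "A :+: B" := (symdiff A B) (at level 52, left associativity).

(* The ground set is a subset of an ambient finite type, so that deletion can
   shrink it without changing the type. *)
Record set_system (T : finType) := SetSystem {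
  ground : {set T};
  feasible : {set {set T}} }.

Section SetSystems.

Variable T : finType.
Implicit Types (D M : set_system T) (A B C F I X Y : {set T}).

(* [set u; v] is [set u] when u = v, as the axiom allows. *)
Definition symmetric_exchange D : Prop :=
  forall X Y, X \in feasible D -> Y \in feasible D ->
  forall u, u \in X :+: Y ->
  exists2 v, v \in X :+: Y & X :+: [set u; v] \in feasible D.

Definition delta_matroid D : Prop :=
  [/\ feasible D != set0,
      forall F, F \in feasible D -> F \subset ground D
    & symmetric_exchange D].

Definition matroid M : Prop :=
  delta_matroid M /\
  (forall X Y, X \in feasible M -> Y \in feasible M -> #|X| = #|Y|).

Definition max_size D : nat := \max_(F in feasible D) #|F|.

(* Feasible sets are subsets of the ground set, so the default value
   #|ground D| does not affect the minimum. *)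
Definition min_size D : nat :=
  \big[minn/#|ground D|]_(F in feasible D) #|F|.

Definition width D : nat := max_size D - min_size D.

Definition twist D A : set_system T :=
  SetSystem (ground D) [set A :+: F | F in feasible D].

Definition Dmin D : set_system T :=
  SetSystem (ground D) [set F in feasible D | #|F| == min_size D].

Definition coloop D (e : T) : bool :=
  (e \in ground D) && [forall F in feasible D, e \in F].

(* Deleting a coloop is contracting it: e is then in every feasible set, hence
   not a loop, and the feasible sets of D / e are the F - e. *)
Definition del D (e : T) : set_system T :=
  SetSystem (ground D :\ e)
    (if coloop D e then [set F :\ e | F in feasible D & e \in F]
     else [set F in feasible D | F \subset ground D :\ e]).

(* The elements of E - A are deleted in the order of their enumeration; for a
   delta-matroid, the order does not matter. *)
Definition restrict D A : set_system T :=
  foldl del D (enum (ground D :\: A)).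

Definition indep M X : bool := [exists B in feasible M, X \subset B].

Definition circuit M C : bool :=
  minset (fun X => (X \subset ground M) && ~~ indep M X) C.

Definition cocircuital M : rel T :=
  fun x y => [exists C : {set T}, [&& circuit M C, x \in C & y \in C]].

(* The components are the classes, on the ground set, of the equivalence
   relation generated by lying in a common circuit. *)
Definition components M : {set {set T}} :=
  [set [set y in ground M | connect (cocircuital M) x y] | x in ground M].

Definition separator M A : Prop :=
  exists2 S : {set {set T}}, S \subset components M & A = cover S.

Definition rank M X : nat := \max_(B in feasible M) #|X :&: B|.

Lemma in_symdiff A B x : (x \in A :+: B) = (x \in A) (+) (x \in B).
Proof. by rewrite !inE; case: (x \in A); case: (x \in B). Qed.

Lemma le_rank M X B : B \in feasible M -> #|X :&: B| <= rank M X.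
Proof. by move=> MB; rewrite /rank (bigmax_sup B). Qed.

Lemma rank_witness M X :
  matroid M -> exists2 B, B \in feasible M & rank M X = #|X :&: B|.
Proof.
case=> -[/set0Pn[B0 MB0] _ _] _.
rewrite /rank; have := eq_bigmax_cond (fun B => #|X :&: B|).
move=> /(_ (mem (feasible M))) []; first by apply/card_gt0P; exists B0.
by move=> B MB ->; exists B.
Qed.

Lemma rank_ground M B : matroid M -> B \in feasible M -> rank M (ground M) = #|B|.
Proof.
move=> MM MB; have [B' MB' ->] := rank_witness (ground M) MM.
have [[_ sub _] eqs] := MM.
by rewrite (setIidPr (sub _ MB')); apply: eqs.
Qed.

Lemma basis_exchange M X Y u : matroid M ->
  X \in feasible M -> Y \in feasible M -> u \in X :\: Y ->
  exists2 v, v \in Y :\: X & v |: (X :\ u) \in feasible M.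
Proof.
move=> [[_ _ ex] eqs] MX MY /setDP[Xu Yu].
have [|v] := ex X Y MX MY u; first by rewrite in_symdiff Xu (negPf Yu).
rewrite in_symdiff => vXY MZ; case Xv: (v \in X) vXY => /= vY.
  have /proper_card : X :+: [set u; v] \proper X.
    apply/properP; split; last by exists u; rewrite // in_symdiff !inE Xu eqxx.
    apply/subsetP=> w; rewrite in_symdiff !inE.
    by case: (w =P u) => [->|_] /=; rewrite ?Xu //;
      case: (w =P v) => [->|_]; rewrite /= ?Xv // addbF.
  by rewrite (eqs _ _ MZ MX) ltnn.
exists v; first by rewrite !inE Xv vY.
suff <-: X :+: [set u; v] = v |: (X :\ u) by [].
apply/setP=> w; rewrite in_symdiff !inE.
case: (w =P v) => [->|_]; first by rewrite Xv orbT.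
by case: (w =P u) => [->|_]; rewrite ?Xu //= addbF.
Qed.

Lemma basis_augment M I B1 B2 : matroid M ->
  B1 \in feasible M -> B2 \in feasible M -> I \subset B1 ->
  exists B, [/\ B \in feasible M, I \subset B & B \subset I :|: B2].
Proof.
move=> MM; have [n] := ubnP #|B1 :\: (I :|: B2)|.
elim: n B1 => // n IHn B1 le_n MB1 MB2 sI.
have [sB|/subsetPn[u B1u]] := boolP (B1 \subset I :|: B2); first by exists B1.
rewrite inE => /norP[Iu B2u].
have [|v /setDP[B2v B1v] MB] := @basis_exchange M B1 B2 u MM MB1 MB2.
  by rewrite inE B1u B2u.
apply: IHn MB MB2 _; last first.
  apply/subsetP=> w Iw; rewrite !inE (subsetP sI w Iw) andbT orbC.
  by case: eqP Iw Iu => // -> ->.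
rewrite ltnS in le_n; apply: leq_trans le_n; apply/proper_card/properP; split.
  apply/subsetP=> w; rewrite !inE; case: (w =P v) => [->|_] /=.
    by rewrite B2v orbT.
  by case/and3P=> -> _ ->.
by exists u; rewrite !inE ?B1u ?(negPf Iu) ?(negPf B2u) //= eqxx /=
  orbF; apply: contra B1v => /eqP <-.
Qed.

Lemma separatorP M A : A \subset ground M ->
  separator M A <->
  (forall C, circuit M C -> C \subset A \/ C \subset ground M :\: A).
Proof.
move=> sA; split=> [[S sS ->] C cC | clA].
  have /minsetP[/andP[sC _] _] := cC.
  have [|/subsetPn[x Cx nSx]] := boolP (C \subset cover S); first by left.
  right; apply/subsetP=> y Cy; rewrite inE (subsetP sC) // andbT.
  apply: contra nSx => /bigcupP[K SK Ky]; apply/bigcupP; exists K => //.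
  have /imsetP[z _ eK] := subsetP sS K SK.
  move: Ky; rewrite eK !inE (subsetP sC x Cx) => /andP[_ zy] /=.
  apply: connect_trans zy (connect1 _); apply/existsP; exists C.
  by rewrite cC Cy Cx.
have clx x y : connect (cocircuital M) x y -> x \in A -> y \in A.
  case/connectP=> p; elim: p x => [|z p IHp] x /=; first by move=> _ ->.
  case/andP=> /existsP[C /and3P[cC Cx Cz]] pz ey Ax; apply: (IHp z) => //.
  case: (clA C cC) => /subsetP sCA; first exact: sCA.
  by have := sCA x Cx; rewrite inE Ax.
exists [set [set y in ground M | connect (cocircuital M) x y] | x in A].
  by apply/imsetS.
apply/eqP; rewrite eqEsubset; apply/andP; split; apply/subsetP=> x.
  move=> Ax; apply/bigcupP.
  exists [set y in ground M | connect (cocircuital M) x y].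
    by apply/imsetP; exists x.
  by rewrite inE (subsetP sA) //= connect0.
by case/bigcupP=> K /imsetP[y Ay ->]; rewrite inE => /andP[_ /clx]; apply.
Qed.

Lemma separator_rank M A : matroid M -> A \subset ground M ->
  separator M A <->
  rank M A + rank M (ground M :\: A) = rank M (ground M).
Proof.
move=> MM sA; have [[_ sub _] eqs] := MM; apply: (iff_trans (separatorP sA)).
set A' := ground M :\: A.
have split_card B : B \subset ground M -> #|B| = #|A :&: B| + #|A' :&: B|.
  move=> sB; rewrite -(cardsID A B) setIC; congr (_ + #|pred_of_set _|).
  apply/setP=> x; rewrite !inE; case: (x \in A) => //=.
  by apply/idP/andP=> [Bx|[]//]; rewrite (subsetP sB).
have [B1 MB1 rA] := rank_witness A MM; have [B2 MB2 rA'] := rank_witness A' MM.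
split=> [clA | eqr C cC].
  apply/eqP; rewrite eqn_leq; apply/andP; split; last first.
    by rewrite (rank_ground MM MB1) (split_card _ (sub _ MB1)) leq_add ?le_rank.
  set I := (A :&: B1) :|: (A' :&: B2).
  have dI : #|I| = rank M A + rank M A'.
    rewrite cardsU rA rA' -[RHS]subn0; congr (_ - _).
    by apply/eqP; rewrite cards_eq0; apply/eqP/setP=> x; rewrite !inE;
       case: (x \in A); rewrite ?andbF.
  have sI : I \subset ground M.
    by rewrite subUset !subIset ?sA ?subsetDl ?(sub _ MB1).
  have [/existsP[B /andP[MB sIB]]|nI] := boolP (indep M I).
    by rewrite -dI (rank_ground MM MB) subset_leq_card.
  have [|C cC sCI] := @minset_exists T
    (fun X => (X \subset ground M) && ~~ indep M X) I; first by rewrite sI.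
  have /minsetP[/andP[_ nC] _] := cC; case/negP: nC; apply/existsP.
  case: (clA C cC) => /subsetP sCA; [exists B1 | exists B2];
    rewrite ?MB1 ?MB2 /=; apply/subsetP=> x Cx;
    have := sCA x Cx; have := subsetP sCI x Cx; rewrite !inE.
    by move=> /orP[/andP[]//|/andP[/andP[/negPf->]]].
  by move=> /orP[/andP[->]|/andP[]].
have /minsetP[/andP[sC nC] minC] := cC.
have sub_indep X : X \subset C -> X != C -> indep M X.
  move=> sX nX; apply: contraNT nX => nX; apply/eqP/minC => //.
  by rewrite (subset_trans sX sC).
have [|/subsetPn[y Cy Ay]] := boolP (C \subset A); first by left.
have [|/subsetPn[x Cx A'x]] := boolP (C \subset A'); first by right.
have Ax : x \in A by apply: contraR A'x => Ax; rewrite inE Ax (subsetP sC).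
have eqB B : B \in feasible M -> #|A :&: B| = rank M A /\ #|A' :&: B| = rank M A'.
  move=> MB; have := rank_ground MM MB; rewrite -eqr (split_card _ (sub _ MB)).
  have := le_rank A MB; have := le_rank A' MB.
  move=> le' le_ e; have e1 : #|A :&: B| = rank M A.
    apply/eqP; rewrite eqn_leq le_ /= -(leq_add2r (rank M A')) e leq_add2l.
    exact: le'.
  by split=> //; apply/eqP; rewrite -(eqn_add2l (rank M A)) e e1.
have /existsP[D1 /andP[MD1 sD1]] : indep M (A :&: C).
  apply: sub_indep; first exact: subsetIr.
  by apply/eqP=> /setP/(_ y); rewrite inE Cy (negPf Ay).
have /existsP[D2 /andP[MD2 sD2]] : indep M (A' :&: C).
  apply: sub_indep; first exact: subsetIr.
  by apply/eqP=> /setP/(_ x); rewrite inE Cx (negPf A'x).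
have [B [MB sIB sBI]] := basis_augment MM MD1 MD2 (subsetIr A D1).
case/negP: nC; apply/existsP; exists B; rewrite MB /=.
have eB' : A' :&: B = A' :&: D2.
  apply/eqP; rewrite eqEcard (eqB _ MB).2 (eqB _ MD2).2 leqnn andbT.
  apply/subsetP=> z; rewrite inE => /andP[A'z Bz]; rewrite inE A'z /=.
  have := subsetP sBI z Bz; rewrite !inE => /orP[/andP[Az _]|//].
  by move: A'z; rewrite inE Az.
apply/subsetP=> z Cz; have [Az|Az] := boolP (z \in A).
  apply: (subsetP sIB); rewrite inE Az; apply: (subsetP sD1).
  by rewrite inE Az.
have A'z : z \in A' by rewrite inE Az (subsetP sC).
have : z \in A' :&: B.
  by rewrite eB' inE A'z; apply: (subsetP sD2); rewrite inE A'z.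
by case/setIP.
Qed.

End SetSystems.

(* Main.v *)
(* Let a and b be the sizes of the traces on A and on E - A of a feasible set of
   minimum size; they do not depend on that set exactly when A separates D_min.
   Write |F :&: A| = a + i and |F - A| = b + j. The feasible sets of D|A are the
   F :&: A with j = 0, and those of D|(E - A) are the F - A with i = 0. Every
   feasible F contains one of minimum size, and exchanging towards it lowers
   (i, j) by a bounded amount; by descent, "D|A is a matroid and D|(E - A) has
   width one" amounts to "j - i is 0 or 1 for every F, and 1 for some F", which
   up to a shift describes the sizes in the twist by A. Conversely, if D*B has
   width one, a parity argument shows that B separates D_min, and A is B or
   E - B according to whether j - i takes the values 0, 1 or -1, 0. *)
Require Import Defs.
From mathcomp Require Import all_boot.
From mathcomp Require Import zify.

Set Implicit Arguments.
Unset Strict Implicit.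
Unset Printing Implicit Defensive.

(** * Extreme sizes of feasible sets, and width one as two consecutive sizes *)

Section MinMax.

Variable T : finType.
Implicit Types (D : set_system T) (A B F G X : {set T}).

Lemma bigmin_seq_leq (I : eqType) (s : seq I) (P : pred I) (f : I -> nat) x0 i :
  i \in s -> P i -> \big[minn/x0]_(j <- s | P j) f j <= f i.
Proof.
elim: s => // j s IHs; rewrite inE big_cons => /orP[/eqP<- ->|si Pi].
  exact: geq_minl.
by case: (P j); rewrite ?geq_min IHs ?orbT.
Qed.

Lemma min_size_leq D F : F \in feasible D -> min_size D <= #|F|.
Proof. by apply: bigmin_seq_leq; apply: mem_index_enum. Qed.

Lemma max_size_geq D F : F \in feasible D -> #|F| <= max_size D.
Proof. by move=> DF; rewrite /max_size (bigmax_sup F). Qed.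

Lemma max_size_attained D : feasible D != set0 ->
  exists2 F, F \in feasible D & #|F| = max_size D.
Proof.
case/set0Pn=> F0 DF0.
have := eq_bigmax_cond (fun F : {set T} => #|F|).
move=> /(_ (mem (feasible D))) []; first by apply/card_gt0P; exists F0.
by move=> F DF eF; exists F; rewrite // /max_size -eF.
Qed.

Lemma min_size_attained D : feasible D != set0 ->
  (forall F, F \in feasible D -> F \subset ground D) ->
  exists2 F, F \in feasible D & #|F| = min_size D.
Proof.
case/set0Pn=> F0 DF0 sub.
have [eg|[F DF eF]] :
    min_size D = #|ground D| \/ exists2 F, F \in feasible D & #|F| = min_size D.
- rewrite /min_size; apply: (big_ind (fun m =>
    m = #|ground D| \/ exists2 F, F \in feasible D & #|F| = m)); first by left.
  + by move=> x y Px Py; rewrite /minn; case: ifP.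
  + by move=> F DF; right; exists F.
(* If the minimum is the default [#|ground D|], any feasible set attains it, being a subset of the
   ground set. *)
- exists F0 => //; apply/eqP; rewrite eqn_leq min_size_leq // andbT eg.
  exact/subset_leq_card/sub.
- by exists F.
Qed.

Lemma width1P D : feasible D != set0 ->
  (forall F, F \in feasible D -> F \subset ground D) ->
  width D = 1 <->
  exists k, [/\ forall F, F \in feasible D -> k <= #|F| <= k.+1,
    exists2 F, F \in feasible D & #|F| = k
    & exists2 F, F \in feasible D & #|F| = k.+1].
Proof.
move=> D0 sub; have [F1 DF1 e1] := max_size_attained D0.
have [F0 DF0 e0] := min_size_attained D0 sub; rewrite /width; split=> [w|].
  exists (min_size D); split; [|by exists F0|by exists F1 => //; lia].
  by move=> F DF; have := min_size_leq DF; have := max_size_geq DF; lia.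
case=> k [bd [F2 DF2 e2] [F3 DF3 e3]].
have := bd _ DF0; have := bd _ DF1; have := min_size_leq DF2.
have := max_size_geq DF3; lia.
Qed.

End MinMax.

(** * Symmetric differences and minimum traces *)

Section DeltaMatroids.

Variable T : finType.
Implicit Types (D : set_system T) (A B F G H S X Y : {set T}).

(** Stated additively, so that no truncated subtraction arises: both sides count [A] and
    [F :\: A]. *)
Lemma card_symdiff A F : #|A :+: F| + #|F :&: A| = #|A| + #|F :\: A|.
Proof.
have -> : #|A :+: F| = #|A :\: F| + #|F :\: A|.
  rewrite cardsU -[RHS]subn0; congr (_ - _); apply/eqP; rewrite cards_eq0.
  by apply/eqP/setP=> x; rewrite !inE; case: (x \in A); rewrite ?andbF.
by rewrite -(cardsID F A) [F :&: A]setIC; lia.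
Qed.

Lemma setI_rel_compl (E A F : {set T}) :
  F \subset E -> F :&: (E :\: A) = F :\: A.
Proof. by move=> sF; rewrite setIDA (setIidPl sF). Qed.

Lemma setD_rel_compl (E A F : {set T}) :
  F \subset E -> F :\: (E :\: A) = F :&: A.
Proof. by rewrite -setD_eq0 setDDr => /eqP->; rewrite set0U. Qed.

(** Start from any set with minimum trace on [X] and exchange towards [F] at a trace element [v]
    outside [F]. Losing [v] brings in at most one element, and that one lies in [F]; so the trace
    stays minimum while its part outside [F] shrinks. *)
Lemma min_trace_subset D X F : delta_matroid D -> F \in feasible D ->
  exists G, [/\ G \in feasible D, G :&: X \subset F
    & forall H, H \in feasible D -> #|G :&: X| <= #|H :&: X|].
Proof.
move=> [_ _ ex] DF.
pose P n := [exists H in feasible D, #|H :&: X| == n].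
have exP : exists n, P n by exists #|F :&: X|; apply/existsP; exists F; rewrite DF /=.
case: (ex_minnP exP) => m /existsP[G0 /andP[DG0 /eqP e0]] minm.
have {}minm H : H \in feasible D -> m <= #|H :&: X|.
  by move=> DH; apply: minm; apply/existsP; exists H; rewrite DH /=.
have [n] := ubnP #|(G0 :&: X) :\: F|.
elim: n G0 DG0 e0 => // n IHn G DG eG le_n.
have [sG|/subsetPn[v]] := boolP (G :&: X \subset F).
  by exists G; split=> // H DH; rewrite eG minm.
rewrite inE => /andP[Gv Xv] Fv.
have [|w] := ex G F DG DF v; first by rewrite in_symdiff Gv (negPf Fv).
set G' := G :+: [set v; w] => GFw DG'.
have inG' x : x \in G' = (x \in G) (+) ((x == v) || (x == w)).
  by rewrite in_symdiff !inE.
clearbody G'; have sG' : G' :&: X \subset w |: ((G :&: X) :\ v).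
  apply/subsetP=> x; rewrite !inE inG'.
  by case: (x =P w) => //= _; case: (x =P v) => [->|_]; rewrite ?Gv ?addbF.
apply: (IHn G') => //; first last.
  rewrite ltnS in le_n; apply: leq_trans le_n; apply/proper_card/properP; split.
    apply/subsetP=> x; rewrite !inE inG' => /andP[Fx].
    case: (x =P v) => [->|_]; first by rewrite Gv.
    case: (x =P w) => [ew|_] /=; last by rewrite addbF Fx.
    by move: GFw; rewrite in_symdiff -ew (negPf Fx) addbF => ->.
  by exists v; rewrite !inE ?Gv ?Xv ?Fv // inG' Gv eqxx.
apply/eqP; rewrite eqn_leq minm // andbT -eG.
apply: leq_trans (subset_leq_card sG') _.
rewrite cardsU1 [leqRHS](cardsD1 v) !inE Gv Xv.
by rewrite leq_add2r leq_b1.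
Qed.

(** * The matroid [Dmin D] and its separators *)

Lemma feasible_DminP D F : delta_matroid D ->
  F \in feasible (Dmin D) <->
  F \in feasible D /\ forall H, H \in feasible D -> #|F| <= #|H|.
Proof.
case=> D0 sub _; rewrite inE; split=> [/andP[DF /eqP eF]|[DF minF]].
  by split=> // H DH; rewrite eF min_size_leq.
have [G DG eG] := min_size_attained D0 sub.
by rewrite DF /= eqn_leq min_size_leq // -eG minF.
Qed.

Lemma Dmin_subset D F : delta_matroid D -> F \in feasible D ->
  exists2 G, G \in feasible (Dmin D) & G \subset F.
Proof.
move=> hD DF; have [G [DG sG minG]] := min_trace_subset setT hD DF.
exists G; last by rewrite setIT in sG.
by apply/feasible_DminP=> //; split=> // H /minG; rewrite !setIT.
Qed.

Lemma symdiff_swap X u v : u \in X -> v \notin X ->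
  X :+: [set u; v] = v |: (X :\ u).
Proof.
move=> Xu Xv; apply/setP=> w; rewrite in_symdiff !inE.
case: (w =P v) => [->|_]; first by rewrite (negPf Xv) orbT.
by case: (w =P u) => [->|_]; rewrite ?Xu //= addbF.
Qed.

Lemma symdiff_sub X u v : u \in X -> v \in X -> X :+: [set u; v] = X :\ u :\ v.
Proof.
move=> Xu Xv; apply/setP=> w; rewrite in_symdiff !inE.
case: (w =P v) => [->|_]; first by rewrite Xv orbT.
by case: (w =P u) => [->|_]; rewrite ?Xu //= addbF.
Qed.

(** For [u] in [X :\: Y], the exchange in [D] cannot remove a second element of [X], by minimality,
    so it is a swap. For [u] in [Y :\: X] the axiom asks for the dual basis exchange, which is
    derived from these swaps. *)
Lemma Dmin_matroid D : delta_matroid D -> matroid (Dmin D).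
Proof.
move=> hD; have [D0 sub ex] := hD.
have eqs X Y : X \in feasible (Dmin D) -> Y \in feasible (Dmin D) -> #|X| = #|Y|.
  by rewrite !inE => /andP[_ /eqP->] /andP[_ /eqP->].
split=> //; split.
- case/set0Pn: D0 => F DF; have [G MG _] := Dmin_subset hD DF.
  by apply/set0Pn; exists G.
- by move=> F; rewrite inE => /andP[/sub].
have exch X Y u : X \in feasible (Dmin D) -> Y \in feasible (Dmin D) ->
    u \in X :\: Y -> exists2 v, v \in Y :\: X & v |: (X :\ u) \in feasible (Dmin D).
  move=> MX MY /setDP[Xu Yu].
  have /(feasible_DminP _ hD)[DX minX] := MX.
  have /(feasible_DminP _ hD)[DY minY] := MY.
  have [|v] := ex X Y DX DY u; first by rewrite in_symdiff Xu (negPf Yu).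
  rewrite in_symdiff; have [Xv|Xv] := boolP (v \in X) => /= Yv.
    rewrite symdiff_sub // => /minX.
    have := subset_leq_card (subD1set (X :\ u) v).
    by rewrite (cardsD1 u X) Xu; lia.
  rewrite symdiff_swap // => DZ; exists v; first by rewrite inE Xv Yv.
  apply/feasible_DminP=> //; split=> // H /minX; apply: leq_trans.
  by rewrite cardsU1 (cardsD1 u X) Xu leq_add2r leq_b1.
move=> X Y MX MY u; rewrite in_symdiff.
have [Xu /= Yu|Xu /= Yu] := boolP (u \in X).
  have [|v /setDP[Yv Xv] MZ] := exch X Y u MX MY; first by rewrite inE Xu Yu.
  exists v; first by rewrite in_symdiff (negPf Xv) Yv.
  by rewrite symdiff_swap.
(* Move Y towards X, keeping u, until u is its only element outside X. *)
suff [Z [MZ Zu sZ sI]] : exists Z, [/\ Z \in feasible (Dmin D), u \in Z,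
    Z \subset u |: X & X :&: Y \subset Z].
  have cZ : #|X :\: Z| = 1.
    have := eqs _ _ MX MZ; rewrite -(cardsID Z X) -(cardsID X Z) setIC.
    suff -> : Z :\: X = [set u] by rewrite cards1; lia.
    apply/setP=> w; rewrite !inE; case: (w =P u) => [->|nu]; first by rewrite Xu Zu.
    apply/negbTE/andP=> -[Xw Zw]; have := subsetP sZ w Zw.
    by rewrite !inE (negPf Xw) orbF => /eqP.
  have /cards1P[v ev] : #|X :\: Z| == 1 by rewrite cZ.
  have /setDP[Xv Zv] : v \in X :\: Z by rewrite ev set11.
  (* This is what [X :&: Y \subset Z] is kept for: [v] is in [X] but not in [Z], hence not in
     [Y]. *)
  exists v.
    rewrite in_symdiff Xv /=; apply: contra Zv => Yv.
    by apply: (subsetP sI); rewrite inE Xv Yv.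
  rewrite setUC symdiff_swap //.
  suff <- : Z = u |: (X :\ v) by [].
  apply/setP=> w; move/setP/(_ w): ev; have := subsetP sZ w; rewrite !inE.
  case: (w =P u) => [->|_] //=; case: (w \in Z) => /= h <-; first by rewrite h.
  by rewrite andNb.
have [n] := ubnP #|Y :\: (u |: X)|.
(* The induction moves a copy [Z] of [Y], while [Y] itself stays fixed in the invariant
   [X :&: Y \subset Z]. *)
have [Z eZ [MZ Zu sI]] : exists2 Z, Y = Z & [/\ Z \in feasible (Dmin D), u \in Z &
   X :&: Y \subset Z] by exists Y; rewrite ?subsetIr.
rewrite {1}eZ; elim: n Z {eZ} MZ Zu sI => // n IHn Z MZ Zu sI le_n.
have [sZ|/subsetPn[w Zw]] := boolP (Z \subset u |: X); first by exists Z.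
rewrite !inE => /norP[nwu Xw].
have [|v /setDP[Xv Zv] MW] := exch Z X w MZ MX; first by rewrite inE Zw Xw.
apply: IHn MW _ _ _.
- by rewrite !inE Zu (eq_sym u w) nwu orbT.
- apply/subsetP=> x xI; rewrite !inE (subsetP sI x xI) andbT.
  by case: (x =P w) xI => [->|]; rewrite ?orbT // inE (negPf Xw).
rewrite ltnS in le_n; apply: leq_trans le_n; apply/proper_card/properP; split.
  apply/subsetP=> x; rewrite !inE; case: (x =P v) => [->|_] /=.
    by rewrite Xv orbT.
  by case/and3P=> -> _ ->.
exists w; rewrite !inE ?(negPf nwu) ?(negPf Xw) ?Zw //= eqxx /= orbF.
by apply: contra Zv => /eqP <-.
Qed.

(** The two traces of a basis add up to the rank and are bounded by the ranks of the two sides.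
    These ranks add up to the total exactly when every basis attains both. *)
Lemma separator_DminP D A : delta_matroid D -> A \subset ground D ->
  separator (Dmin D) A <->
  (forall F G, F \in feasible (Dmin D) -> G \in feasible (Dmin D) ->
     #|F :&: A| = #|G :&: A|).
Proof.
move=> hD sA; have MM := Dmin_matroid hD; have [[_ sub _] eqs] := MM.
apply: (iff_trans (separator_rank MM sA)).
have split_card F : F \in feasible (Dmin D) ->
    #|F| = #|A :&: F| + #|(ground D :\: A) :&: F|.
  move=> MF; rewrite -(cardsID A F) setIC; congr (_ + #|pred_of_set _|).
  apply/setP=> x; rewrite !inE; case: (x \in A) => //=.
  by apply/idP/andP=> [Bx|[]//]; rewrite (subsetP (sub _ MF)).
have [B1 MB1 r1] := rank_witness A MM.
have [B2 MB2 r2] := rank_witness (ground D :\: A) MM.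
rewrite (rank_ground MM MB1); split=> [e F G MF MG | cst].
  suff K H : H \in feasible (Dmin D) -> #|H :&: A| = rank (Dmin D) A by rewrite !K.
  move=> MH; rewrite setIC; have := le_rank A MH.
  have := le_rank (ground D :\: A) MH; have := split_card _ MH.
  by move: e; rewrite (eqs _ _ MB1 MH) /=; lia.
rewrite r1 r2 /=; have := cst _ _ MB1 MB2; rewrite [B1 :&: A]setIC [B2 :&: A]setIC.
by move=> ->; rewrite -split_card //; apply: eqs.
Qed.

(** * Deletion and restriction *)

(** Treats both branches of [del] at once: [G] may contain [e] only if [e] is unavoidable. *)
Lemma feasible_delP D e F : delta_matroid D ->
  F \in feasible (del D e) <->
  exists2 G, G \in feasible D & F = G :\ e /\
    (e \in G -> forall H, H \in feasible D -> e \in H).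
Proof.
case=> D0 sub _; rewrite /del /=.
have colP : coloop D e <-> forall H, H \in feasible D -> e \in H.
  split=> [/andP[_ /forallP cl] H DH | cl]; first by have := cl H; rewrite DH.
  apply/andP; split.
    by case/set0Pn: D0 => H DH; apply: (subsetP (sub _ DH)); apply: cl.
  by apply/forallP=> H; apply/implyP/cl.
case: ifPn => [/colP cl | ncl].
  split=> [/imsetP[G]|[G DG [-> _]]].
    by rewrite inE => /andP[DG Ge] ->; exists G.
  by apply: imset_f; rewrite inE DG cl.
rewrite inE subsetD1; split=> [/and3P[DF _ Fe] | [G DG [-> h]]].
  by exists F => //; split; [apply/setP=> x; rewrite !inE; case: eqP => // -> ;
    apply/negbTE | rewrite (negPf Fe)].
have Ge : e \notin G by apply: contra ncl => /h/colP.
suff -> : G :\ e = G by rewrite DG sub.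
by apply/setP=> x; rewrite !inE; case: eqP => // ->; rewrite (negPf Ge).
Qed.

Lemma delta_matroid_del D e : delta_matroid D -> delta_matroid (del D e).
Proof.
move=> hD; have [D0 sub ex] := hD; split.
- case/set0Pn: D0 => F DF; have [G [DG _ minG]] := min_trace_subset [set e] hD DF.
  apply/set0Pn; exists (G :\ e); apply/feasible_delP=> //; exists G => //.
  split=> // Ge H /minG; have -> : G :&: [set e] = [set e] by apply/setIidPr; rewrite sub1set.
  rewrite cards1 => /card_gt0P[x]; rewrite !inE => /andP[Hx /eqP ex'].
  by rewrite -ex'.
- by move=> F /(feasible_delP _ _ hD)[G DG [-> _]]; apply/setSD/sub.
move=> _ _ /(feasible_delP _ _ hD)[X DX [-> hX]] /(feasible_delP _ _ hD)[Y DY [-> hY]] u.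
rewrite in_symdiff !inE; have [->//|nue /= XYu] := eqVneq u e.
(* As [X] and [Y] agree at [e], the exchange never touches [e], and its result survives the
   deletion. *)
have eXY : (e \in X) = (e \in Y).
  by apply/idP/idP=> [/hX/(_ Y DY)|/hY/(_ X DX)].
have [|v XYv DZ] := ex X Y DX DY u; first by rewrite in_symdiff.
have nve : v != e.
  by apply: contraTneq XYv => ->; rewrite in_symdiff eXY addbb.
exists v; first by move: XYv; rewrite !in_symdiff !inE nve.
apply/feasible_delP=> //; exists (X :+: [set u; v]) => //; split.
  apply/setP=> x; rewrite in_symdiff !in_setD1 in_symdiff !inE.
  by case: (x =P e) => [->|]; rewrite // ![e == _]eq_sym (negPf nue) (negPf nve).
by rewrite in_symdiff !inE ![e == _]eq_sym (negPf nue) (negPf nve) addbF.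
Qed.

Lemma delta_matroid_foldl_del D s :
  delta_matroid D -> delta_matroid (foldl (@del T) D s).
Proof. by elim: s D => //= e s IHs D hD; apply/IHs/delta_matroid_del. Qed.

(** An element is dropped from feasible sets only when they all contain it, so what survives comes
    from the sets meeting [s] least. This form does not mention the order of deletion. *)
Lemma feasible_foldl_delP D s F : delta_matroid D -> uniq s ->
  F \in feasible (foldl (@del T) D s) <->
  exists2 G, G \in feasible D & F = G :\: [set x in s] /\
    (forall H, H \in feasible D ->
       #|G :&: [set x in s]| <= #|H :&: [set x in s]|).
Proof.
move=> hD; have [_ _ ex] := hD.
elim/last_ind: s F => [|s e IHs] F.
  have -> : [set x in [::]] = set0 :> {set T} by apply/setP=> x; rewrite !inE.
  move=> _; split=> [DF|[G DG [-> _]]]; last by rewrite setD0.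
  by exists F => //; split=> [|H _]; rewrite ?setD0 // setI0 cards0.
rewrite rcons_uniq => /andP[se us]; rewrite foldl_rcons.
set X := [set x in s] in IHs *.
have Xe : e \notin X by rewrite inE.
have -> : [set x in rcons s e] = e |: X.
  by apply/setP=> x; rewrite !inE mem_rcons inE.
have {}IHs F' := IHs F' us.
have cardI H : #|H :&: (e |: X)| = (e \in H) + #|H :&: X|.
  rewrite (cardsD1 e) !inE eqxx andbT; congr (_ + #|pred_of_set _|).
  apply/setP=> x; rewrite !inE; case: (x =P e) => [->|] //=.
  by rewrite (negPf se) andbF.
have DU G : G :\: X :\ e = G :\: (e |: X) by rewrite setDDl setUC.
have inD G : (e \in G :\: X) = (e \in G) by rewrite inE Xe.
apply: (iff_trans (feasible_delP _ _ (delta_matroid_foldl_del s hD))).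
split=> [[_ /IHs[G DG [-> minG]] [-> he]] | [G DG [-> minG]]].
  exists G => //; split=> // H DH; rewrite !cardI.
  have [Ge|Ge] := boolP (e \in G); last by have := minG _ DH; lia.
  have [le|lt] := ltnP #|G :&: X| #|H :&: X|; first by lia.
  (* Here [H] also has minimum trace on [X], so it survives the earlier deletions and must contain
     [e]. *)
  rewrite -(inD H) he ?inD //; first by have := minG _ DH; lia.
  apply/IHs; exists H => //; split=> // H' DH'.
  exact: leq_trans lt (minG _ DH').
have [H [DH sH minH]] := min_trace_subset X hD DG.
have [HG|GH] := leqP #|G :&: X| #|H :&: X|.
  have mG : G :\: X \in feasible (foldl (@del T) D s).
    by apply/IHs; exists G => //; split=> // K DK; apply: leq_trans HG (minH _ DK).
  exists (G :\: X) => //; rewrite DU inD; split=> // Ge _ /IHs[K DK [-> minK]].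
  rewrite inD; have := minG _ DK; rewrite !cardI Ge; have := minK _ DG.
  by case: (e \in K) => //; lia.
(* Now every feasible set with the fewest elements in X contains e, whereas G
   avoids e and has one element u more in X: exchanging u can only bring in e. *)
have full K : K \in feasible D -> #|K :&: X| <= #|H :&: X| -> e \in K.
  by move=> DK; have := minG _ DK; rewrite !cardI; case: (e \in K) => //; lia.
have He := full H DH (leqnn _).
have Ge : e \notin G.
  by apply/negP=> Ge; have := minG _ DH; rewrite !cardI Ge He; lia.
have cGH : #|G :&: X| = #|H :&: X|.+1.
  by have := minG _ DH; rewrite !cardI He (negPf Ge); lia.
have sHG : H :&: X \subset G :&: X by rewrite subsetI sH subsetIr.
have /cards1P[u eu] : #|(G :&: X) :\: (H :&: X)| == 1.
  by have := cardsID (H :&: X) (G :&: X); rewrite (setIidPr sHG) cGH; lia.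
have Du x : ((x \in G) && (x \in X) && ~~ ((x \in H) && (x \in X))) = (x == u).
  by move/setP/(_ x): eu; rewrite in_set1 => <-; rewrite !in_setD !in_setI andbC.
have := Du u; rewrite eqxx => /andP[/andP[Gu Xu]]; rewrite Xu andbT => Hu.
have [|v GHv DZ] := ex G H DG DH u; first by rewrite in_symdiff Gu (negPf Hu).
set Z := G :+: _ in DZ.
have inZ x : x \in Z = (x \in G) (+) ((x == u) || (x == v)).
  by rewrite in_symdiff !inE.
clearbody Z; have Zu : u \notin Z by rewrite inZ Gu eqxx.
(* If [v] lies in [X], it is in [G], because [H :&: X] is contained in [G]; so the exchange adds
   nothing to the trace on [X], and [Z] has minimum trace there. *)
have sZ : Z :&: X \subset (G :&: X) :\ u.
  apply/subsetP=> x; rewrite in_setI => /andP[Zx Xx].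
  have nxu : x != u by apply: contraNneq Zu => <-.
  rewrite in_setD1 in_setI nxu Xx andbT /=.
  move: Zx; rewrite inZ (negPf nxu) /=.
  case: (x =P v) => [exv|_]; last by rewrite addbF => ->.
  have := Du x; rewrite (negPf nxu) Xx !andbT.
  have := subsetP sHG x; rewrite !in_setI Xx !andbT.
  move: GHv; rewrite -exv in_symdiff.
  by case: (x \in G); case: (x \in H) => //= _ h; have := h isT.
have leZ : #|Z :&: X| <= #|H :&: X|.
  apply: leq_trans (subset_leq_card sZ) _.
  by rewrite -ltnS -cGH [ltnRHS](cardsD1 u) inE Gu Xu.
have ev : e = v.
  have := full Z DZ leZ; rewrite inZ (negPf Ge) /=.
  by case/orP=> /eqP// eeu; move: Xe; rewrite eeu Xu.
(* [Z] is [G] with [u] replaced by [e]. Both are among the deleted elements, so [Z] and [G] leave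
   the same set. *)
exists (Z :\: X); last first.
  split=> [|_ _ /IHs[K DK [-> minK]]]; last by rewrite inD full ?minK.
  apply/setP=> x; rewrite !inE inZ -ev.
  case: (x =P e) => //= _; case: (x =P u) => [->|_]; last by rewrite addbF.
  by move: Xu; rewrite inE => ->.
by apply/IHs; exists Z => //; split=> // K DK; apply: leq_trans leZ (minH _ DK).
Qed.

Lemma feasible_restrictP D A F : delta_matroid D ->
  F \in feasible (restrict D A) <->
  exists2 G, G \in feasible D & F = G :&: A /\
    (forall H, H \in feasible D -> #|G :\: A| <= #|H :\: A|).
Proof.
move=> hD; have [_ sub _] := hD.
apply: (iff_trans (feasible_foldl_delP _ hD (enum_uniq _))).
have -> : [set x in enum (ground D :\: A)] = ground D :\: A.
  by apply/setP=> x; rewrite inE mem_enum.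
have eI G : G \in feasible D -> G :&: (ground D :\: A) = G :\: A.
  by move/sub/setI_rel_compl.
have eD G : G \in feasible D -> G :\: (ground D :\: A) = G :&: A.
  by move/sub/setD_rel_compl.
split=> -[G DG [-> minG]]; exists G => //; split; rewrite ?eD // => H DH;
  by have := minG _ DH; rewrite !eI.
Qed.

Lemma delta_matroid_restrict D A :
  delta_matroid D -> delta_matroid (restrict D A).
Proof. exact: delta_matroid_foldl_del. Qed.

(** * Sizes in the two restrictions *)

(** As [G] lies inside [F], an exchange towards [G] only removes elements. Starting at some [u] in
    [S], the three cases are [v = u], another [v] in [S], and [v] outside [S]. *)
Lemma exchange_down D F G S : delta_matroid D ->
  F \in feasible D -> G \in feasible D -> G \subset F ->
  #|G :&: S| < #|F :&: S| ->
  exists2 F', F' \in feasible D &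
    [\/ #|F' :&: S|.+1 = #|F :&: S| /\ #|F' :\: S| = #|F :\: S|,
        #|F' :&: S|.+2 = #|F :&: S| /\ #|F' :\: S| = #|F :\: S|
      | #|F' :&: S|.+1 = #|F :&: S| /\ #|F' :\: S|.+1 = #|F :\: S|].
Proof.
move=> [_ _ ex] DF DG sGF lt.
have /subsetPn[u] : ~~ (F :&: S \subset G :&: S).
  by apply: contraL lt => /subset_leq_card; rewrite -leqNgt.
rewrite !inE => /andP[Fu Su]; rewrite Su andbT => Gu.
have [|v] := ex F G DF DG u; first by rewrite in_symdiff Fu (negPf Gu).
rewrite in_symdiff => FGv DF'.
have Fv : v \in F by have := subsetP sGF v; move: FGv; case: (v \in F) => //= ->; apply.
rewrite symdiff_sub // in DF'; exists (F :\ u :\ v) => //.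
have eI1 X x : (X :\ x) :&: S = (X :&: S) :\ x by rewrite setIDAC.
have eD1 X x : (X :\ x) :\: S = (X :\: S) :\ x by rewrite !setDDl setUC.
rewrite !eI1 !eD1.
rewrite (cardsD1 u (F :&: S)) (cardsD1 u (F :\: S)) !inE Fu Su /=.
rewrite (cardsD1 v ((F :&: S) :\ u)) (cardsD1 v ((F :\: S) :\ u)) !inE Fv !andbT.
have [->|_] := eqVneq v u; first by constructor 1; lia.
by case: (v \in S); [constructor 2 | constructor 3]; lia.
Qed.

(** With [i] and [j] the excesses of [F] over [B0] inside and outside [A], the right side says that
    [j - i] is 0 or 1 throughout and 1 somewhere, written without subtraction. *)
Lemma restrict_width1P D A B0 : delta_matroid D -> A \subset ground D ->
  B0 \in feasible (Dmin D) -> separator (Dmin D) A ->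
  (matroid (restrict D A) /\ width (restrict D (ground D :\: A)) = 1) <->
  (forall F, F \in feasible D ->
     #|F :&: A| + #|B0 :\: A| <= #|F :\: A| + #|B0 :&: A|
       <= (#|F :&: A| + #|B0 :\: A|).+1) /\
  (exists2 F, F \in feasible D &
     #|F :\: A| + #|B0 :&: A| = (#|F :&: A| + #|B0 :\: A|).+1).
Proof.
move=> hD sA MB0 /(separator_DminP hD sA) sep.
have [_ sub ex] := hD; have [_ eqs] := Dmin_matroid hD.
have DB0 : B0 \in feasible D by case/(feasible_DminP _ hD): MB0.
have basis F : F \in feasible D -> exists G, [/\ G \in feasible D, G \subset F,
    #|G :&: A| = #|B0 :&: A| & #|G :\: A| = #|B0 :\: A|].
  move=> DF; have [G MG sG] := Dmin_subset hD DF; have e := sep _ _ MG MB0.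
  exists G; split=> //; first by case/(feasible_DminP _ hD): MG.
  by have := eqs _ _ MG MB0; rewrite -(cardsID A G) -(cardsID A B0) e => /addnI.
have ge_a F : F \in feasible D -> #|B0 :&: A| <= #|F :&: A|.
  by case/basis=> G [_ sG <- _]; apply/subset_leq_card/setSI.
have ge_b F : F \in feasible D -> #|B0 :\: A| <= #|F :\: A|.
  by case/basis=> G [_ sG _ <-]; apply/subset_leq_card/setSD.
have downA F : F \in feasible D -> #|B0 :&: A| < #|F :&: A| ->
    exists2 F', F' \in feasible D &
    [\/ #|F' :&: A|.+1 = #|F :&: A| /\ #|F' :\: A| = #|F :\: A|,
        #|F' :&: A|.+2 = #|F :&: A| /\ #|F' :\: A| = #|F :\: A|
      | #|F' :&: A|.+1 = #|F :&: A| /\ #|F' :\: A|.+1 = #|F :\: A|].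
  by move=> DF; have [G [DG sG <- _]] := basis _ DF; apply: exchange_down.
have downA' F : F \in feasible D -> #|B0 :\: A| < #|F :\: A| ->
    exists2 F', F' \in feasible D &
    [\/ #|F' :\: A|.+1 = #|F :\: A| /\ #|F' :&: A| = #|F :&: A|,
        #|F' :\: A|.+2 = #|F :\: A| /\ #|F' :&: A| = #|F :&: A|
      | #|F' :\: A|.+1 = #|F :\: A| /\ #|F' :&: A|.+1 = #|F :&: A|].
  move=> DF; have [G [DG sG _ <-]] := basis _ DF.
  (* Complementing [S] interchanges the two traces. *)
  have := @exchange_down D F G (~: A) hD DF DG sG.
  rewrite -!setDE => h /h[F' DF' hF']; exists F' => //.
  by move: hF'; rewrite -!setDE !(setDE _ (~: A)) setCK.
have resA F : F \in feasible (restrict D A) <->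
    exists2 G, G \in feasible D & F = G :&: A /\ #|G :\: A| = #|B0 :\: A|.
  apply: (iff_trans (feasible_restrictP _ _ hD)).
  split=> -[G DG [-> h]]; exists G => //; split=> //; last by rewrite h.
  by apply/eqP; rewrite eqn_leq h // ge_b.
have resA' F : F \in feasible (restrict D (ground D :\: A)) <->
    exists2 G, G \in feasible D & F = G :\: A /\ #|G :&: A| = #|B0 :&: A|.
  have eI G : G \in feasible D -> G :&: (ground D :\: A) = G :\: A.
    by move/sub/setI_rel_compl.
  have eD G : G \in feasible D -> G :\: (ground D :\: A) = G :&: A.
    by move/sub/setD_rel_compl.
  apply: (iff_trans (feasible_restrictP _ _ hD)).
  split=> -[G DG [-> h]]; exists G => //; rewrite eI // ?eD //; split=> //.
    by apply/eqP; rewrite eqn_leq ge_a // andbT; have := h _ DB0; rewrite !eD.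
  by move=> H DH; rewrite !eD // h ge_a.
have [R0 Rsub _] := delta_matroid_restrict (ground D :\: A) hD.
rewrite (width1P R0 Rsub); split.
  case=> -[_ eqA] [k [bd [_ /resA'[G0 DG0 [-> a0]] e0] [_ /resA'[G1 DG1 [-> a1]] e1]]].
  have kb : k = #|B0 :\: A|.
    apply/eqP; rewrite eqn_leq -{2}e0 ge_b // andbT.
    have /bd/andP[//] : B0 :\: A \in feasible (restrict D (ground D :\: A)).
    by apply/resA'; exists B0.
  have bdA' F : F \in feasible D -> #|F :&: A| = #|B0 :&: A| ->
      #|F :\: A| <= #|B0 :\: A|.+1.
    move=> DF e; rewrite -kb.
    have /bd/andP[//] : F :\: A \in feasible (restrict D (ground D :\: A)).
    by apply/resA'; exists F.
  have bdA F : F \in feasible D -> #|F :\: A| = #|B0 :\: A| ->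
      #|F :&: A| = #|B0 :&: A|.
    by move=> DF e; apply: eqA; apply/resA; [exists F | exists B0].
  split; last by exists G1 => //; lia.
  move=> F DF; apply/andP; split.
    (* Lower bound: lowering [j] never increases [j - i], and at [j = 0] the matroid [restrict D A]
       forces [i = 0]. *)
    have [n] := ubnP #|F :\: A|; elim: n F DF => // n IHn F DF le_n.
    have [e|ne] := eqVneq #|F :\: A| #|B0 :\: A|.
      by rewrite e bdA // addnC.
    have [|F' DF' h] := downA' F DF; first by have := ge_b _ DF; lia.
    have lt_n : #|F' :\: A| < n by case: h => -[]; lia.
    by have := IHn _ DF' lt_n; case: h => -[]; lia.
  (* Upper bound: lowering [i] never decreases [j - i], and at [i = 0] width one gives [j <= 1]. *)
  have [n] := ubnP #|F :&: A|; elim: n F DF => // n IHn F DF le_n.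
  have [e|ne] := eqVneq #|F :&: A| #|B0 :&: A|.
    by have := bdA' _ DF e; lia.
  have [|F' DF' h] := downA F DF; first by have := ge_a _ DF; lia.
  have lt_n : #|F' :&: A| < n by case: h => -[]; lia.
  by have := IHn _ DF' lt_n; case: h => -[]; lia.
case=> bd [F1 DF1 e1]; split.
  split; first exact: delta_matroid_restrict.
  have K G : G \in feasible D -> #|G :\: A| = #|B0 :\: A| -> #|G :&: A| = #|B0 :&: A|.
    by move=> DG e; have := bd _ DG; have := ge_a _ DG; lia.
  by move=> _ _ /resA[X DX [-> eX]] /resA[Y DY [-> eY]]; rewrite !K.
exists #|B0 :\: A|; split.
- move=> _ /resA'[G DG [-> e]]; have := bd _ DG; lia.
- by exists (B0 :\: A) => //; apply/resA'; exists B0.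
(* Lowering [i] keeps [j - i] at least 1, hence equal to 1 by [bd]; at [i = 0] this yields the
   larger size. *)
have [n] := ubnP #|F1 :&: A|; elim: n F1 DF1 e1 => // n IHn F DF e le_n.
have [ea|ne] := eqVneq #|F :&: A| #|B0 :&: A|.
  by exists (F :\: A); [apply/resA'; exists F | lia].
have [|F' DF' h] := downA F DF; first by have := ge_a _ DF; lia.
have bd' := bd _ DF'; apply: (IHn _ DF'); case: h => -[]; lia.
Qed.

(** * Sizes in a twist *)

(** By [card_symdiff], [k] and [k.+1] are the sizes of the sets [B :+: F]; [#|F :&: B|] is moved
    across to avoid subtraction. *)
Lemma twist_width1P D B : delta_matroid D -> B \subset ground D ->
  width (twist D B) = 1 <->
  exists k, [/\ forall F, F \in feasible D ->
      k + #|F :&: B| <= #|B| + #|F :\: B| <= (k + #|F :&: B|).+1,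
    exists2 F, F \in feasible D & #|B| + #|F :\: B| = k + #|F :&: B|
    & exists2 F, F \in feasible D & #|B| + #|F :\: B| = (k + #|F :&: B|).+1].
Proof.
move=> [/set0Pn[F0 DF0] sub _] sB.
have tw0 : feasible (twist D B) != set0.
  by apply/set0Pn; exists (B :+: F0); apply: imset_f.
have twsub F : F \in feasible (twist D B) -> F \subset ground (twist D B).
  by case/imsetP=> G DG ->; rewrite subUset !subDset !subsetU ?sB ?sub ?orbT.
apply: (iff_trans (width1P tw0 twsub)); have cs := card_symdiff B.
split=> -[k [bd h0 h1]]; exists k; split.
- move=> F DF; have := bd (B :+: F) (imset_f _ DF); have := cs F; lia.
- by case: h0 => _ /imsetP[F DF ->] e; exists F => //; have := cs F; lia.
- by case: h1 => _ /imsetP[F DF ->] e; exists F => //; have := cs F; lia.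
- by move=> _ /imsetP[F DF ->]; have := bd F DF; have := cs F; lia.
- by case: h0 => F DF e; exists (B :+: F); [apply: imset_f | have := cs F; lia].
- by case: h1 => F DF e; exists (B :+: F); [apply: imset_f | have := cs F; lia].
Qed.

End DeltaMatroids.

Theorem theorem1p1 (T : finType) (D : set_system T) (hD : delta_matroid D) :
  (exists2 B : {set T}, B \subset ground D & width (twist D B) = 1) <->
  (exists2 A : {set T}, A \subset ground D &
    [/\ separator (Dmin D) A,
        matroid (restrict D A)
      & width (restrict D (ground D :\: A)) = 1]).
Proof.
have [D0 sub _] := hD; have [_ eqs] := Dmin_matroid hD.
have [B0 MB0] : exists B0, B0 \in feasible (Dmin D).
  by case/set0Pn: D0 => F /(Dmin_subset hD)[B0 MB0 _]; exists B0.
have DB0 : B0 \in feasible D by case/(feasible_DminP _ hD): MB0.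
split=> [[B sB /(twist_width1P hD sB)[k [bd [F0 DF0 e0] [F1 DF1 e1]]]] | ].
  (* On the sets of minimum size, #|F :\: B| - #|F :&: B| has constant parity,
     so it is constant, being confined to two consecutive values. *)
  have cst F : F \in feasible (Dmin D) -> #|F :&: B| = #|B0 :&: B|.
    move=> MF; have DF : F \in feasible D by case/(feasible_DminP _ hD): MF.
    have := eqs _ _ MF MB0; rewrite -(cardsID B F) -(cardsID B B0).
    by have := bd _ DF; have := bd _ DB0; lia.
  have eD F : F \in feasible D -> F :\: (ground D :\: B) = F :&: B.
    by move/sub/setD_rel_compl.
  have eI F : F \in feasible D -> F :&: (ground D :\: B) = F :\: B.
    by move/sub/setI_rel_compl.
  (* If [B :+: B0] has the smaller size, then [A] is [B] and [F1] witnesses the value 1. *)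
  have [e|ne] := eqVneq (#|B| + #|B0 :\: B|) (k + #|B0 :&: B|).
    exists B => //; have sep : separator (Dmin D) B.
      by apply/(separator_DminP hD sB)=> F G MF MG; rewrite !cst.
    have /(restrict_width1P hD sB MB0 sep)[] //:
      (forall F, F \in feasible D ->
         #|F :&: B| + #|B0 :\: B| <= #|F :\: B| + #|B0 :&: B|
           <= (#|F :&: B| + #|B0 :\: B|).+1) /\
      (exists2 F, F \in feasible D &
         #|F :\: B| + #|B0 :&: B| = (#|F :&: B| + #|B0 :\: B|).+1).
    split=> [F DF|]; first by have := bd _ DF; lia.
    by exists F1 => //; lia.
  (* Now [B :+: B0] has the larger size. Passing to the complement negates [j - i], so [F0], of the
     smaller size, becomes the witness. *)
  have e := bd _ DB0.
  set A := ground D :\: B; have sA : A \subset ground D by apply: subsetDl.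
  exists A => //; have sep : separator (Dmin D) A.
    apply/(separator_DminP hD sA).
    suff K F : F \in feasible (Dmin D) -> #|F :&: A| = #|B0 :\: B|.
      by move=> F G MF MG; rewrite !K.
    move=> MF; have := eqs _ _ MF MB0; rewrite -(cardsID B F) -(cardsID B B0) cst //.
    by case/(feasible_DminP _ hD): MF => DF _; rewrite eI // => /addnI.
  have /(restrict_width1P hD sA MB0 sep)[] //:
    (forall F, F \in feasible D ->
       #|F :&: A| + #|B0 :\: A| <= #|F :\: A| + #|B0 :&: A|
         <= (#|F :&: A| + #|B0 :\: A|).+1) /\
    (exists2 F, F \in feasible D &
       #|F :\: A| + #|B0 :&: A| = (#|F :&: A| + #|B0 :\: A|).+1).
  split=> [F DF|]; first by rewrite !eD ?eI //; have := bd _ DF; lia.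
  by exists F0 => //; rewrite !eD ?eI //; lia.
case=> A sA [sep MA wA]; exists A => //.
have /(restrict_width1P hD sA MB0 sep)[bd [F1 DF1 e1]] := conj MA wA.
(* The constant chosen next is the size of [A :+: B0]; this bound makes its truncated subtraction
   exact. *)
have leA : #|B0 :&: A| <= #|A| by apply/subset_leq_card/subsetIr.
apply/(twist_width1P hD sA); exists (#|A| + #|B0 :\: A| - #|B0 :&: A|); split.
- by move=> F DF; have := bd _ DF; lia.
- by exists B0 => //; lia.
- by exists F1 => //; lia.
Qed.
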